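(* Let $K$ be an algebraically closed field of characteristic $0$, let $A_1$ be the first Weyl algebra over $K$, and let $k,n$ be integers with $k>n\ge1$. If $k$ or $n$ is prime, then $\Gamma\cap A_1(k,n)=\emptyset$.
   Context: $A_1$ is the associative $K$-algebra generated by $\mathbf{p},\mathbf{q}$ with relation $[\mathbf{q},\mathbf{p}]=1$; the elements $\mathbf{p}^i\mathbf{q}^j$ ($i,j\ge0$) form a $K$-basis. For $k,n\in\mathbb{Z}_{\ge0}$, $A_1(k,n)$ is the set of $z=\sum a_{ij}\mathbf{p}^i\mathbf{q}^j\in A_1$ with $a_{kn}\ne0$ and $a_{ij}=0$ whenever $i>k$ or $j>n$. $\Gamma=\{z\in A_1\mid \exists\, w\in A_1,\ [z,w]=1\}$. *)

(* Defs.v *)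
From HB Require Import structures.
From mathcomp Require Import all_boot all_algebra.
From mathcomp Require Import boolp classical_sets.

Set Implicit Arguments.
Unset Strict Implicit.
Unset Printing Implicit Defensive.

Import GRing.Theory.
Local Open Scope ring_scope.
Local Open Scope quotient_scope.

(* The first Weyl algebra is built literally from its presentation: formal    *)
(* K-algebra expressions in two letters, modulo the smallest congruence that  *)
(* contains the axioms of associative unital K-algebras and [q, p] = 1.       *)

Inductive wterm (K : fieldType) : Type :=
| WConst of K
| WP
| WQ
| WAdd of wterm K & wterm K
| WOpp of wterm K
| WMul of wterm K & wterm K.

Arguments WP {K}.
Arguments WQ {K}.

HB.instance Definition _ (K : fieldType) := gen_eqMixin (wterm K).
HB.instance Definition _ (K : fieldType) := gen_choiceMixin (wterm K).

Inductive wcong (K : fieldType) : wterm K -> wterm K -> Prop :=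
| wcong_refl x : wcong x x
| wcong_sym x y : wcong x y -> wcong y x
| wcong_trans y x z : wcong x y -> wcong y z -> wcong x z
| wcong_add x x' y y' :
    wcong x x' -> wcong y y' -> wcong (WAdd x y) (WAdd x' y')
| wcong_opp x x' : wcong x x' -> wcong (WOpp x) (WOpp x')
| wcong_mul x x' y y' :
    wcong x x' -> wcong y y' -> wcong (WMul x y) (WMul x' y')
| wcong_addA x y z : wcong (WAdd x (WAdd y z)) (WAdd (WAdd x y) z)
| wcong_addC x y : wcong (WAdd x y) (WAdd y x)
| wcong_add0 x : wcong (WAdd (WConst 0) x) x
| wcong_addN x : wcong (WAdd (WOpp x) x) (WConst 0)
| wcong_mulA x y z : wcong (WMul x (WMul y z)) (WMul (WMul x y) z)
| wcong_mul1 x : wcong (WMul (WConst 1) x) x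
| wcong_mulDl x y z :
    wcong (WMul (WAdd x y) z) (WAdd (WMul x z) (WMul y z))
| wcong_mulDr x y z :
    wcong (WMul x (WAdd y z)) (WAdd (WMul x y) (WMul x z))
| wcong_constD a b : wcong (WConst (a + b)) (WAdd (WConst a) (WConst b))
| wcong_constM a b : wcong (WConst (a * b)) (WMul (WConst a) (WConst b))
| wcong_central a x : wcong (WMul (WConst a) x) (WMul x (WConst a))
| wcong_weyl :
    wcong (WAdd (WMul WQ WP) (WOpp (WMul WP WQ))) (WConst 1).

Section WeylQuotient.
Variable K : fieldType.

Definition wrel (x y : wterm K) : bool := `[< wcong x y >].

Lemma wrel_refl : reflexive wrel.
Proof. by move=> x; apply/asboolP/wcong_refl. Qed.

Lemma wrel_sym : symmetric wrel.
Proof. by move=> x y; apply/asboolP/asboolP; apply: wcong_sym. Qed.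

Lemma wrel_trans : transitive wrel.
Proof.
move=> y x z /asboolP xy /asboolP yz; apply/asboolP.
exact: wcong_trans xy yz.
Qed.

Canonical wrel_equiv := EquivRel wrel wrel_refl wrel_sym wrel_trans.

End WeylQuotient.

Definition weyl (K : fieldType) : Type := {eq_quot @wrel_equiv K}.

Section WeylAlgebra.
Variable K : fieldType.
Local Notation T := (wterm K).
Local Notation A1 := (weyl K).

HB.instance Definition _ := Choice.on A1.
HB.instance Definition _ := EqQuotient.on A1.

Definition weyl_class (x : T) : A1 := \pi_A1 x.

Lemma weyl_classP (x y : T) : weyl_class x = weyl_class y <-> wcong x y.
Proof.
by rewrite /weyl_class; split=> [/eqmodP/asboolP //|xy]; apply/eqmodP/asboolP.
Qed.

Lemma weyl_class_repr (u : A1) : weyl_class (repr u) = u.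
Proof. exact: reprK. Qed.

Lemma weyl_ind (P : A1 -> Prop) : (forall x, P (weyl_class x)) -> forall u, P u.
Proof. by move=> Px u; rewrite -(weyl_class_repr u). Qed.

Definition weyl_add (u v : A1) := weyl_class (WAdd (repr u) (repr v)).
Definition weyl_opp (u : A1) := weyl_class (WOpp (repr u)).
Definition weyl_mul (u v : A1) := weyl_class (WMul (repr u) (repr v)).
Definition weyl_scale (a : K) (u : A1) :=
  weyl_class (WMul (WConst a) (repr u)).

Lemma wcong_repr (x : T) : wcong (repr (weyl_class x)) x.
Proof. by apply/weyl_classP; rewrite weyl_class_repr. Qed.

Lemma weyl_addE x y :
  weyl_add (weyl_class x) (weyl_class y) = weyl_class (WAdd x y).
Proof. by apply/weyl_classP/wcong_add; apply: wcong_repr. Qed.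

Lemma weyl_oppE x : weyl_opp (weyl_class x) = weyl_class (WOpp x).
Proof. by apply/weyl_classP/wcong_opp/wcong_repr. Qed.

Lemma weyl_mulE x y :
  weyl_mul (weyl_class x) (weyl_class y) = weyl_class (WMul x y).
Proof. by apply/weyl_classP/wcong_mul; apply: wcong_repr. Qed.

Lemma weyl_scaleE a x :
  weyl_scale a (weyl_class x) = weyl_class (WMul (WConst a) x).
Proof. by apply/weyl_classP/wcong_mul; [apply: wcong_refl|apply: wcong_repr]. Qed.

Let E := (weyl_addE, weyl_oppE, weyl_mulE, weyl_scaleE).

Lemma weyl_addA : associative weyl_add.
Proof.
by do 3!elim/weyl_ind=> ?; rewrite !E; apply/weyl_classP/wcong_addA.
Qed.

Lemma weyl_addC : commutative weyl_add.
Proof. by do 2!elim/weyl_ind=> ?; rewrite !E; apply/weyl_classP/wcong_addC. Qed.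

Lemma weyl_add0 : left_id (weyl_class (WConst 0)) weyl_add.
Proof. by elim/weyl_ind=> ?; rewrite !E; apply/weyl_classP/wcong_add0. Qed.

Lemma weyl_addN : left_inverse (weyl_class (WConst 0)) weyl_opp weyl_add.
Proof. by elim/weyl_ind=> ?; rewrite !E; apply/weyl_classP/wcong_addN. Qed.

HB.instance Definition _ :=
  GRing.isZmodule.Build A1 weyl_addA weyl_addC weyl_add0 weyl_addN.

Lemma weyl_mulA : associative weyl_mul.
Proof.
by do 3!elim/weyl_ind=> ?; rewrite !E; apply/weyl_classP/wcong_mulA.
Qed.

Lemma weyl_mul1l : left_id (weyl_class (WConst 1)) weyl_mul.
Proof. by elim/weyl_ind=> ?; rewrite !E; apply/weyl_classP/wcong_mul1. Qed.

Lemma weyl_mul1r : right_id (weyl_class (WConst 1)) weyl_mul.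
Proof.
elim/weyl_ind=> x; rewrite !E; apply/weyl_classP.
exact: wcong_trans (wcong_sym (wcong_central 1 x)) (wcong_mul1 x).
Qed.

Lemma weyl_mulDl : left_distributive weyl_mul +%R.
Proof.
do 3!elim/weyl_ind=> ?; rewrite /GRing.add /= !E.
exact/weyl_classP/wcong_mulDl.
Qed.

Lemma weyl_mulDr : right_distributive weyl_mul +%R.
Proof.
do 3!elim/weyl_ind=> ?; rewrite /GRing.add /= !E.
exact/weyl_classP/wcong_mulDr.
Qed.

(* The algebra is nontrivial: it acts on K[X], with p acting as              *)
(* multiplication by 'X and q as d/dX.                                       *)
Fixpoint weyl_act (x : T) (f : {poly K}) : {poly K} :=
  match x with
  | WConst a => a *: f
  | WP => 'X * f
  | WQ => f^`()
  | WAdd y z => weyl_act y f + weyl_act z f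
  | WOpp y => - weyl_act y f
  | WMul y z => weyl_act y (weyl_act z f)
  end.

Lemma weyl_act_linear x a f g :
  weyl_act x (a *: f + g) = a *: weyl_act x f + weyl_act x g.
Proof.
elim: x f g => [b|||y IHy z IHz|y IHy|y IHy z IHz] f g /=.
- by rewrite scalerDr !scalerA mulrC.
- by rewrite mulrDr scalerAr.
- by rewrite derivD derivZ.
- by rewrite IHy IHz scalerDr addrACA.
- by rewrite IHy opprD scalerN.
- by rewrite IHz IHy.
Qed.

Lemma weyl_actD x f g : weyl_act x (f + g) = weyl_act x f + weyl_act x g.
Proof. by have := weyl_act_linear x 1 f g; rewrite !scale1r. Qed.

Lemma weyl_actZ x a f : weyl_act x (a *: f) = a *: weyl_act x f.
Proof.
have x0 : weyl_act x 0 = 0.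
  by apply: (addrI (weyl_act x 0)); rewrite -weyl_actD !addr0.
by have := weyl_act_linear x a f 0; rewrite x0 !addr0.
Qed.

Lemma wcong_act x y : wcong x y -> weyl_act x =1 weyl_act y.
Proof.
elim=> {x y} /=.
- by [].
- by move=> x y _ IH f; rewrite IH.
- by move=> y x z _ IH1 _ IH2 f; rewrite IH1 IH2.
- by move=> x x' y y' _ IH1 _ IH2 f; rewrite IH1 IH2.
- by move=> x x' _ IH f; rewrite IH.
- by move=> x x' y y' _ IH1 _ IH2 f; rewrite IH2 IH1.
- by move=> x y z f; rewrite addrA.
- by move=> x y f; rewrite addrC.
- by move=> x f; rewrite scale0r add0r.
- by move=> x f; rewrite addNr scale0r.
- by [].
- by move=> x f; rewrite scale1r.
- by [].
- by move=> x y z f; rewrite weyl_actD.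
- by move=> a b f; rewrite scalerDl.
- by move=> a b f; rewrite scalerA.
- by move=> a x f; rewrite weyl_actZ.
- by move=> f; rewrite derivM derivX mul1r addrK scale1r.
Qed.

Lemma weyl_one_neq0 : weyl_class (WConst 1) != weyl_class (WConst 0).
Proof.
apply/eqP=> /weyl_classP/wcong_act/(_ 1) /=; rewrite scale1r scale0r.
by move/eqP; rewrite oner_eq0.
Qed.

HB.instance Definition _ :=
  GRing.Zmodule_isNzRing.Build A1 weyl_mulA weyl_mul1l weyl_mul1r
    weyl_mulDl weyl_mulDr weyl_one_neq0.

Lemma weyl_scaleA a b u : weyl_scale a (weyl_scale b u) = weyl_scale (a * b) u.
Proof.
elim/weyl_ind: u => x; rewrite !E; apply/weyl_classP.
apply: (wcong_trans (wcong_mulA _ _ _)).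
by apply: wcong_mul; [apply/wcong_sym/wcong_constM|apply: wcong_refl].
Qed.

Lemma weyl_scale1 : left_id 1 weyl_scale.
Proof. by elim/weyl_ind=> ?; rewrite !E; apply/weyl_classP/wcong_mul1. Qed.

Lemma weyl_scaleDr : right_distributive weyl_scale +%R.
Proof.
move=> a; do 2!elim/weyl_ind=> ?; rewrite /GRing.add /= !E.
exact/weyl_classP/wcong_mulDr.
Qed.

Lemma weyl_scaleDl u : {morph weyl_scale^~ u : a b / a + b}.
Proof.
elim/weyl_ind: u => x a b; rewrite /GRing.add /= !E; apply/weyl_classP.
apply: wcong_trans (wcong_mulDl _ _ _).
by apply: wcong_mul; [apply: wcong_constD|apply: wcong_refl].
Qed.

HB.instance Definition _ :=
  GRing.Zmodule_isLmodule.Build K A1 weyl_scaleA weyl_scale1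
    weyl_scaleDr weyl_scaleDl.

Lemma weyl_scaleAl (a : K) (u v : A1) : a *: (u * v) = (a *: u) * v.
Proof.
elim/weyl_ind: u => x; elim/weyl_ind: v => y.
rewrite /GRing.scale /GRing.mul /= !E.
exact/weyl_classP/wcong_mulA.
Qed.

HB.instance Definition _ :=
  GRing.Lmodule_isLalgebra.Build K A1 weyl_scaleAl.

Lemma weyl_scaleAr (a : K) (u v : A1) : a *: (u * v) = u * (a *: v).
Proof.
elim/weyl_ind: u => x; elim/weyl_ind: v => y.
rewrite /GRing.scale /GRing.mul /= !E; apply/weyl_classP.
apply: (wcong_trans (wcong_mulA _ _ _)).
apply: wcong_trans (wcong_sym (wcong_mulA _ _ _)).
by apply: wcong_mul; [apply: wcong_central|apply: wcong_refl].
Qed.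

HB.instance Definition _ :=
  GRing.Lalgebra_isAlgebra.Build K A1 weyl_scaleAr.

Definition weyl_p : A1 := weyl_class WP.
Definition weyl_q : A1 := weyl_class WQ.

End WeylAlgebra.

Arguments weyl_p {K}.
Arguments weyl_q {K}.

Definition comm_bracket (R : pzRingType) (x y : R) : R := x * y - y * x.

Lemma weyl_relation (K : fieldType) :
  comm_bracket weyl_q weyl_p = 1 :> weyl K.
Proof.
rewrite /comm_bracket /weyl_p /weyl_q /GRing.mul /GRing.opp /GRing.add /=.
by rewrite !weyl_mulE weyl_oppE weyl_addE; apply/weyl_classP/wcong_weyl.
Qed.

(* As a vanishes outside the box i <= k, j <= n, the finite sum over the box  *)
(* is the whole expansion of z in the basis p^i q^j.                          *)
Definition weyl_box (K : fieldType) (k n : nat) : set (weyl K) :=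
  [set z | exists a : nat -> nat -> K,
    [/\ a k n != 0,
        forall i j : nat, (k < i)%N || (n < j)%N -> a i j = 0
      & z = \sum_(i < k.+1) \sum_(j < n.+1)
              a i j *: (weyl_p ^+ i * weyl_q ^+ j)]].

Definition weyl_Gamma (K : fieldType) : set (weyl K) :=
  [set z | exists w : weyl K, comm_bracket z w = 1].

Arguments weyl_box K k n : clear implicits.
Arguments weyl_Gamma K : clear implicits.

(* Main.v *)
Require Import Defs.
From mathcomp Require Import all_boot all_order all_algebra.
From mathcomp Require Import boolp classical_sets.
From mathcomp Require Import ring lra zify.

(* An element of A_1 is written as sum_j a_j(x) D^j; the leading coefficient  *)
(* a_n is nonconstant, so x can be translated to make it vanish at 0.  Let    *)
(* [z, w] = 1 with w of D-degree s.  Comparing leading coefficients, if n     *)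
(* divides s then w_s = u z_n^(s/n), and w - u z^(s/n) is a dual of z of      *)
(* smaller degree.  So assume n prime to s.  Vertices of the Newton polygons  *)
(* of z and w facing the same direction of positive weight are parallel, as   *)
(* long as [z, w] has lower weight than expected.  Hence the upper left       *)
(* corners are (nm, n) and (sm, s) with m >= 1.  As the constant coefficient  *)
(* of [z, w] is nonzero, z or w contains a monomial D^j with j >= 1, so that  *)
(* some edge starting at these corners and facing x = 0 has slope sg > m,     *)
(* steep enough for the parallelism to hold at its lower end (i, e): then n   *)
(* divides e, so e = 0 and i = n(m - sg) < 0, a contradiction.  If k is the   *)
(* prime, exchange p and q.                                                   *)

Set Implicit Arguments.
Unset Strict Implicit.
Unset Printing Implicit Defensive.

Import Order.TTheory GRing.Theory Num.Theory.
Local Open Scope ring_scope.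

(** * The Weyl product on symbols *)

Section StarProduct.
Variable K : fieldType.
Local Notation S := {poly {poly K}}.
Implicit Types (a b c : S) (f : {poly K}).

(** Elements of $A_1$ become differential operators, polynomials in [D] over [K[x]] with product
    [star]. Give [x] weight -1 and [D] weight [sg > 1]: each differentiation lowers the weight of a
    product by [sg - 1], so the leading part of a commutator is a Poisson bracket, and a pair of
    vertices (i0, j0), (i1, j1) enters it with factor j0 i1 - j1 i0. Since [z, w] = 1 has only a
    constant term, this factor vanishes unless the total weight is exactly [sg - 1]
    ([vertices_parallel]).

    Let z have prime [D]-degree n with leading coefficient vanishing at 0, and let w have [D]-degree
    s not divisible by n. In a very steep direction the parallelism makes the top corners
    proportional; in the direction of a steepest edge below them it makes the lower ends
    proportional too. Primality then leaves the lower end for z either at its corner, which a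
    genuine edge forbids, or at [D]-exponent 0 with negative [x]-exponent. Hence n divides s
    ([star_comm1_dvd]).

    The top of w is then a multiple of a power of the top of z ([star_comm1_top_power]), and
    subtracting a multiple of a power of z lowers s forever ([no_dual_of_prime_degree]). The
    generator whose exponent is prime is the one sent to [D] up to sign. *)

Definition derx b : S := map_poly (@deriv K) b.

Lemma coef_derx b j : (derx b)`_j = (b`_j)^`().
Proof. by rewrite coef_map. Qed.

Lemma derxD a b : derx (a + b) = derx a + derx b.
Proof. by apply/polyP=> j; rewrite !(coefD, coef_derx) derivD. Qed.

Lemma derxZ f b : derx (f *: b) = f^`() *: b + f *: derx b.
Proof. by apply/polyP=> j; rewrite !(coefD, coef_derx, coefZ) derivM. Qed.

Lemma derxXM b : derx ('X * b) = 'X * derx b.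
Proof.
by apply/polyP=> j; rewrite !(coefXM, coef_derx); case: j => [|j] /=;
  rewrite ?deriv0.
Qed.

Lemma coef_iter_derx t b j : (iter t derx b)`_j = (b`_j)^`(t).
Proof. by elim: t j => [|t IH] j //=; rewrite coef_derx IH. Qed.

(* A symbol sum_j a_j(x) D^j is a polynomial in the outer variable 'X = D;    *)
(* lmulD is left multiplication by the operator D.                            *)
Definition lmulD b : S := 'X * b + derx b.

Lemma lmulD_add a b : lmulD (a + b) = lmulD a + lmulD b.
Proof. by rewrite /lmulD derxD mulrDr addrACA. Qed.

Lemma lmulDZ f b : lmulD (f *: b) = f *: lmulD b + f^`() *: b.
Proof. by rewrite /lmulD derxZ scalerDr -scalerAr; ring. Qed.

Lemma lmulD0 : lmulD 0 = 0.
Proof. by rewrite /lmulD mulr0 /derx map_poly0 addr0. Qed.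

Lemma lmulD_sum I r (P : pred I) (F : I -> S) :
  lmulD (\sum_(i <- r | P i) F i) = \sum_(i <- r | P i) lmulD (F i).
Proof. exact: (big_morph lmulD lmulD_add lmulD0). Qed.

Definition star a b : S := \sum_(j < size a) a`_j *: iter j lmulD b.

Lemma starE N a b : (size a <= N)%N ->
  star a b = \sum_(j < N) a`_j *: iter j lmulD b.
Proof.
move=> aN; rewrite /star (big_ord_widen N (fun j => a`_j *: iter j lmulD b)) //.
rewrite big_mkcond; apply: eq_bigr => j _.
by case: ltnP => // aj; rewrite nth_default // scale0r.
Qed.

Lemma starDl a b c : star (a + b) c = star a c + star b c.
Proof.
pose N := maxn (size a) (size b).
rewrite !(@starE N) ?leq_maxl ?leq_maxr // ?size_polyD //.
by rewrite -big_split; apply: eq_bigr => j _; rewrite coefD scalerDl.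
Qed.

Lemma starZl f a c : star (f *: a) c = f *: star a c.
Proof.
rewrite !(@starE (size a)) ?size_scale_leq // scaler_sumr.
by apply: eq_bigr => j _; rewrite coefZ scalerA.
Qed.

Lemma star0l c : star 0 c = 0.
Proof. by rewrite /star size_poly0 big_ord0. Qed.

Lemma star_suml I r (P : pred I) (F : I -> S) c :
  star (\sum_(i <- r | P i) F i) c = \sum_(i <- r | P i) star (F i) c.
Proof. exact: (big_morph (star^~ c) (fun a b => starDl a b c) (star0l c)). Qed.

Lemma iter_lmulD_add j a b :
  iter j lmulD (a + b) = iter j lmulD a + iter j lmulD b.
Proof. by elim: j => //= j ->; rewrite lmulD_add. Qed.

Lemma iter_lmulDZ j (u : K) b :
  iter j lmulD (u%:P *: b) = u%:P *: iter j lmulD b.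
Proof. by elim: j => //= j ->; rewrite lmulDZ derivC scale0r addr0. Qed.

Lemma starDr a b c : star a (b + c) = star a b + star a c.
Proof.
rewrite /star -big_split; apply: eq_bigr => j _.
by rewrite iter_lmulD_add scalerDr.
Qed.

Lemma star0r a : star a 0 = 0.
Proof. by apply: (addrI (star a 0)); rewrite -starDr !addr0. Qed.

Lemma starZr (u : K) a b : star a (u%:P *: b) = u%:P *: star a b.
Proof.
rewrite /star scaler_sumr; apply: eq_bigr => j _.
by rewrite iter_lmulDZ !scalerA mulrC.
Qed.

(** This is associativity with [D] as left factor; the general case follows by iterating it and by
    linearity over [K[x]] on the left. *)
Lemma star_lmulD b c : star (lmulD b) c = lmulD (star b c).
Proof.
have sD : (size (derx b) <= size b)%N by exact: size_poly.
rewrite /lmulD starDl -/(lmulD _) (@starE (size b).+1 ('X * b)); last first.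
  by rewrite mulrC; have [->|b0] := eqVneq b 0; rewrite ?mul0r ?size_mulX ?size_poly0.
rewrite big_ord_recl coefXM scale0r add0r (@starE (size b) (derx b)) //.
rewrite -big_split lmulD_sum; apply: eq_bigr => j _.
by rewrite lmulDZ coefXM /= coef_derx.
Qed.

Lemma star_assoc a b c : star a (star b c) = star (star a b) c.
Proof.
rewrite {2}/star star_suml {1}/star; apply: eq_bigr => j _.
rewrite starZl; congr (_ *: _).
by elim: (val j) => //= i ->; rewrite star_lmulD.
Qed.

Lemma star_polyC f b : star f%:P b = f *: b.
Proof.
by rewrite (@starE 1) ?size_polyC_leq1 // big_ord1 coefC.
Qed.

Lemma starX b : star 'X b = lmulD b.
Proof.
rewrite (@starE 2) ?size_polyX // big_ord_recr big_ord1 !coefX /=.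
by rewrite scale0r add0r scale1r.
Qed.

Lemma derxXn j : derx 'X^j = 0.
Proof.
apply/polyP=> i; rewrite coef_derx coefXn coef0.
by case: (_ == _); rewrite -?polyC1 ?derivC ?deriv0.
Qed.

Lemma star1r a : star a 1 = a.
Proof.
rewrite -[RHS]coefK poly_def; apply: eq_bigr => j _; congr (_ *: _).
elim: (val j) => [|i /= ->]; first by rewrite expr0.
by rewrite /lmulD derxXn addr0 exprS.
Qed.

(** The Leibniz rule for $D^j \circ b$, by Pascal's rule. *)
Lemma iter_lmulDE j b :
  iter j lmulD b = \sum_(t < j.+1) ('X^(j - t) * iter t derx b) *+ 'C(j, t).
Proof.
have derx_sum I r (P : pred I) (F : I -> S) :
    derx (\sum_(i <- r | P i) F i) = \sum_(i <- r | P i) derx (F i).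
  by apply: (big_morph derx derxD); rewrite /derx map_poly0.
have derxMn c m : derx (c *+ m) = derx c *+ m.
  elim: m => [|m IH]; first by rewrite !mulr0n /derx map_poly0.
  by rewrite !mulrS derxD IH.
have derxXnM i c : derx ('X^i * c) = 'X^i * derx c.
  by elim: i => [|i IH]; rewrite ?mul1r // exprS -!mulrA derxXM IH.
elim: j => [|j IH]; first by rewrite big_ord1 subnn mul1r.
rewrite iterS IH lmulD_sum [in RHS]big_ord_recl /= subn0 bin0.
under [X in _ = _ + X]eq_bigr do rewrite /bump /= add1n subSS binS mulrnDr.
rewrite [in RHS]big_split /= addrA /lmulD big_split /=; congr (_ + _); last first.
  by apply: eq_bigr => t _; rewrite derxMn derxXnM.
rewrite [in RHS]big_ord_recr /= bin_small // mulr0n addr0.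
rewrite big_ord_recl /= bin0 subn0 mulr1n mulrA -exprS; congr (_ + _).
apply: eq_bigr => t _; rewrite /bump /= add1n mulrnAr mulrA -exprS.
by rewrite subnSK.
Qed.

(** The Leibniz terms in which [b] is differentiated at least once. The terms [t = 0] form the
    commutative product, which cancels in a commutator. *)
Definition star_rest a b : S :=
  \sum_(0 <= j < size a) \sum_(1 <= t < j.+1)
    (a`_j *: ('X^(j - t) * iter t derx b)) *+ 'C(j, t).

Lemma star_restE a b : star a b = a * b + star_rest a b.
Proof.
rewrite -[a in a * b]coefK poly_def mulr_suml /star /star_rest big_mkord.
rewrite -big_split; apply: eq_bigr => j _ /=.
rewrite iter_lmulDE.
rewrite -(big_mkord xpredT (fun t => ('X^(j - t) * iter t derx b) *+ 'C(j, t))).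
rewrite big_ltn // subn0 bin0 scalerDr -scalerAl; congr (_ + _).
by rewrite scaler_sumr; apply: eq_bigr => t _; rewrite scalerMnr.
Qed.

(** The functional [l] is the identity when only [D]-degrees matter and an [x]-coefficient when
    single monomials do. The factor [j0] is the binomial coefficient of one differentiation. *)
Lemma coef_star_rest1 (V : zmodType) (l : {additive {poly K} -> V}) a b J j0 j1 :
    (J.+1 = j0 + j1)%N ->
    (forall j t j', (0 < t <= j)%N -> (j + j' = J + t)%N ->
       ~~ ((j == j0) && (t == 1%N)) -> l (a`_j * (b`_j')^`(t)) = 0) ->
  l (star_rest a b)`_J = l (a`_j0 * (b`_j1)^`()) *+ j0.
Proof.
move=> J01 H.
rewrite /star_rest coef_sum raddf_sum /=.
transitivity (\sum_(0 <= j < size a | j == j0)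
    \sum_(1 <= t < j.+1 | t == 1%N) l (a`_j0 * (b`_j1)^`()) *+ j0).
  rewrite [RHS]big_mkcond; apply: eq_bigr => j _.
  rewrite coef_sum raddf_sum /=.
  transitivity (\sum_(1 <= t < j.+1 | (j == j0) && (t == 1%N))
      l (a`_j0 * (b`_j1)^`()) *+ j0); last first.
    by case: eqP => _ //; rewrite big_pred0.
  rewrite [RHS]big_mkcond; apply: eq_big_nat => t /andP[t0 tj].
  rewrite coefMn raddfMn coefZ coefXnM coef_iter_derx.
  have [/andP[/eqP jj0 /eqP t1]|nj] := boolP ((j == j0) && (t == 1%N)).
    subst j t; rewrite bin1; case: ltnP => Jj; first by lia.
    by congr (l (_ * (_`_ _)^`() ) *+ _); lia.
  case: ltnP => Jj; first by rewrite mulr0 raddf0 mul0rn.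
  by rewrite H ?mul0rn //; lia.
rewrite big_nat1_eq /=; case: ltnP => aj0; last first.
  by rewrite nth_default // mul0r raddf0 mul0rn.
rewrite big_nat1_eq /=; case: j0 {J01 H aj0} => //.
Qed.

End StarProduct.

(** * Leading coefficients *)

Lemma coefM_top (R : nzSemiRingType) (f g : {poly R}) k m :
  (size f <= k.+1)%N -> (size g <= m.+1)%N -> (f * g)`_(k + m) = f`_k * g`_m.
Proof.
move=> fk gm; rewrite coefM.
have kkm : (k < (k + m).+1)%N by lia.
rewrite (bigD1 (Ordinal kkm)) //= big1 ?addr0 ?addKn // => j; rewrite -val_eqE /= => jk.
have [kj|jk'] := ltnP k j; first by rewrite (nth_default _ (leq_trans fk kj)) mul0r.
by rewrite [g`__](nth_default _ (leq_trans gm _)) ?mulr0 //; lia.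
Qed.

Section CharZero.
Variable K : fieldType.
Hypothesis charK0 : [pchar K] =i pred0.
Local Notation S := {poly {poly K}}.
Implicit Types (a b c : S) (f g : {poly K}).

Lemma pchar0_natr_inj m n : m%:R = n%:R :> K -> m = n.
Proof.
have natr0 := (pcharf0P K).1 charK0.
wlog mn : m n / (m <= n)%N => [IH|].
  by have [/IH//|/ltnW/IH] := leqP m n; move=> + /esym => /[apply].
move=> /eqP; rewrite eq_sym -subr_eq0 -natrB // natr0; lia.
Qed.

Lemma pchar0_mulrIn f n : (0 < n)%N -> f *+ n = 0 -> f = 0.
Proof.
move=> n0 fn; apply/polyP=> i; rewrite coef0; move/polyP/(_ i): fn.
rewrite coefMn coef0 -mulr_natr => /eqP; rewrite mulf_eq0 ((pcharf0P K).1 charK0).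
by rewrite eqn0Ngt n0 orbF => /eqP.
Qed.

(** The operator [x d/dx] keeps degrees and multiplies a leading coefficient by the degree.
    Multiplying the equation by [x] and comparing top coefficients gives the claim in characteristic
    0. *)
Lemma deriv_ode_degree f g t : f != 0 -> g != 0 ->
  f * g^`() = (g * f^`()) *+ t -> (size g).-1 = (t * (size f).-1)%N.
Proof.
move=> f0 g0 ode.
have coefXderiv (h : {poly K}) i : ('X * h^`())`_i = h`_i *+ i.
  by rewrite coefXM; case: i => [|i]; rewrite ?mulr0n // coef_deriv.
have sizeXderiv (h : {poly K}) : (size ('X * h^`())%R <= (size h).-1.+1)%N.
  apply/leq_sizeP => i hi.
  by rewrite coefXderiv nth_default ?mul0rn // (leq_trans (leqSpred _) hi).
set k := (size f).-1; set m := (size g).-1.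
have fk : (size f <= k.+1)%N by exact: leqSpred.
have gm : (size g <= m.+1)%N by exact: leqSpred.
have fk0 : f`_k != 0 by rewrite -/(lead_coef f) lead_coef_eq0.
have gm0 : g`_m != 0 by rewrite -/(lead_coef g) lead_coef_eq0.
have E : f * ('X * g^`()) = (g * ('X * f^`())) *+ t.
  by rewrite mulrCA ode mulrnAr mulrCA.
have := congr1 (fun h : {poly K} => h`_(k + m)) E.
rewrite /= (coefM_top fk (sizeXderiv g)) coefMn addnC.
rewrite (coefM_top gm (sizeXderiv f)) !coefXderiv.
rewrite -[g`_m *+ m]mulr_natr -[f`_k *+ k]mulr_natr -[_ *+ t]mulr_natr => H.
apply: pchar0_natr_inj; rewrite natrM.
by apply: (mulfI fk0); apply: (mulfI gm0); rewrite mulrCA H; ring.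
Qed.

(** The equation says g'/g = t f'/f. Subtract from [g] the multiple of [f ^+ t] with the same
    leading coefficient: the difference solves the same equation, but lacks the term in the only
    degree a nonzero solution can have. *)
Lemma deriv_ode_power f g t : f != 0 ->
  f * g^`() = (g * f^`()) *+ t -> exists u, g = u *: f ^+ t.
Proof.
move=> f0 ode; exists (lead_coef g / lead_coef (f ^+ t)); apply/eqP.
rewrite -subr_eq0; apply/negPn/negP=> h0; move: (h0).
set u := _ / _; set h := g - _ in h0 *; case/negP.
have F0 : f ^+ t != 0 by rewrite expf_neq0.
have g0 : g != 0.
  apply/negP=> /eqP g0; case/negP: h0.
  by rewrite /h /u g0 lead_coef0 mul0r scale0r subr0.
have odeF : f * (f ^+ t)^`() = (f ^+ t * f^`()) *+ t.
  rewrite deriv_exp -mulrnAr; case: (t) => [|r]; first by rewrite !mulr0n !mulr0.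
  by rewrite !mulrnAr /=; congr (_ *+ _); rewrite exprS; ring.
have odeh : f * h^`() = (h * f^`()) *+ t.
  rewrite /h derivB derivZ mulrBr mulrBl mulrnBl ode -scalerAr odeF.
  by rewrite -scalerAl scalerMnr.
have dg := deriv_ode_degree f0 g0 ode.
have dF := deriv_ode_degree f0 F0 odeF.
have dh := deriv_ode_degree f0 h0 odeh.
rewrite -lead_coef_eq0 /lead_coef dh -dg /h coefB coefZ -/(lead_coef g).
by rewrite dg -dF -/(lead_coef _) /u divfK ?subrr // lead_coef_eq0.
Qed.

Lemma star_comm_restE a b : star a b - star b a = star_rest a b - star_rest b a.
Proof. by rewrite !star_restE [b * a]mulrC opprD addrACA subrr add0r. Qed.

(** The coefficient of $D^{n+nt-1}$ in the commutator is $n\,a_n b_{nt}' - nt\,b_{nt} a_n'$. It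
    vanishes because [1 < n] makes that exponent positive. *)
Lemma star_comm1_top_power a b n t : (1 < n)%N ->
    (size a <= n.+1)%N -> (size b <= (n * t).+1)%N -> a`_n != 0 ->
    star a b - star b a = 1 ->
  exists u, b`_(n * t) = u *: a`_n ^+ t.
Proof.
move=> n1 an bs an0; rewrite star_comm_restE => E.
pose J := (n + n * t).-1.
have J1 : (J.+1 = n + n * t)%N by rewrite /J; lia.
have J1' : (J.+1 = n * t + n)%N by rewrite /J; lia.
apply: deriv_ode_power => //; apply/eqP; rewrite -subr_eq0; apply/eqP.
apply: (@pchar0_mulrIn _ n); first by lia.
have := congr1 (fun c : S => c`_J) E; rewrite /= coefB.
have top j j' u (c d : S) k l : (size c <= k.+1)%N -> (size d <= l.+1)%N ->
    (0 < u <= j)%N -> (j + j' + 1 = k + l + u)%N -> ~~ ((j == k) && (u == 1%N)) ->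
    idfun (c`_j * (d`_j')^`(u)) = 0.
  move=> ck dl u1 jj' ju; have [kj|jk] := ltnP k j.
    by rewrite /= (nth_default _ (leq_trans ck kj)) mul0r.
  rewrite /= [d`__](nth_default _ (leq_trans dl _)); last by lia.
  by rewrite derivn_poly0 ?size_poly0 ?mulr0.
have R1 := @coef_star_rest1 K {poly K} idfun a b J n (n * t)%N J1 _.
have R2 := @coef_star_rest1 K {poly K} idfun b a J (n * t)%N n J1' _.
rewrite /= in R1 R2.
rewrite R1 ?R2; last 2 first.
- by move=> j u j' u1 jj; apply: (top j j' u b a (n * t)%N n) => //; lia.
- by move=> j u j' u1 jj; apply: (top j j' u a b n (n * t)%N) => //; lia.
rewrite coef1; have -> : (J == 0)%N = false by rewrite /J; lia.
by rewrite mulrnBl mulrnA mulrnAC => ->.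
Qed.

End CharZero.

(** * Newton polygons *)

Section Newton.
Variable K : fieldType.
Hypothesis charK0 : [pchar K] =i pred0.
Local Notation S := {poly {poly K}}.
Implicit Types (a b c : S) (f g : {poly K}) (sg : rat).

(* x has weight -1 and D has weight sg; ties go to the lowest power of D. *)
Definition newton_vertex sg a (i j : nat) :=
  a`_j`_i != 0 /\ forall i' j', a`_j'`_i' != 0 ->
    sg * j'%:R - i'%:R <= sg * j%:R - i%:R /\
    (sg * j'%:R - i'%:R = sg * j%:R - i%:R -> (j <= j')%N).

(** A contribution to position (I, J) with [t] differentiations comes from monomials whose weights
    exceed the maximal total by (t - 1)(sg - 1). So [t = 1], both monomials have maximal weight, and
    the tie-break leaves one pair. *)
Lemma coef_star_rest_vertices sg a b i0 j0 i1 j1 I J :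
    1 < sg -> newton_vertex sg a i0 j0 -> newton_vertex sg b i1 j1 ->
    (I.+1 = i0 + i1)%N -> (J.+1 = j0 + j1)%N ->
  (star_rest a b)`_J`_I = (a`_j0`_i0 * b`_j1`_i1) *+ (j0 * i1).
Proof.
move=> sg1 [a0 Ha] [b0 Hb] EI EJ.
have only i j i' j' t : a`_j`_i != 0 -> b`_j'`_i' != 0 -> (0 < t)%N ->
    (i + i' = I + t)%N -> (j + j' = J + t)%N -> [/\ t = 1%N, i = i0 & j = j0].
  move=> aij bij t0 Ei Ej.
  have [la ea] := Ha _ _ aij; have [lb eb] := Hb _ _ bij.
  have Ei' : i%:R + i'%:R + 1 = i0%:R + i1%:R + t%:R :> rat.
    by rewrite -natrD -[1]/(1%:R) -!natrD; apply/eqP; rewrite eqr_nat; lia.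
  have Ej' : j%:R + j'%:R + 1 = j0%:R + j1%:R + t%:R :> rat.
    by rewrite -natrD -[1]/(1%:R) -!natrD; apply/eqP; rewrite eqr_nat; lia.
  have t1 : t = 1%N.
    apply/eqP; rewrite eqn_leq t0 andbT -(ler_nat rat).
    nra.
  have Ea : sg * j%:R - i%:R = sg * j0%:R - i0%:R by subst t; nra.
  have Eb : sg * j'%:R - i'%:R = sg * j1%:R - i1%:R by subst t; nra.
  have := ea Ea; have := eb Eb => j1j j0j.
  have jj0 : j = j0 by lia.
  split => //; subst j t; apply/eqP; rewrite -(eqr_nat rat); apply/eqP; lra.
have := @coef_star_rest1 K _ (coefp I) a b J j0 j1 EJ _.
rewrite /= /coefp => ->; last first.
  move=> j t j' /andP[t0 tj] Ej nt; rewrite coefM big1 // => i _.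
  rewrite coef_derivn.
  have [->|ai] := eqVneq (a`_j`_i) 0; first by rewrite mul0r.
  have [->|bi] := eqVneq (b`_j'`_(t + (I - i))) 0; first by rewrite mul0rn mulr0.
  have iI := ltn_ord i.
  have [|t1 _ jj] := only _ _ _ _ t ai bi t0 _ Ej; first by lia.
  by rewrite t1 jj !eqxx in nt.
rewrite mulnC mulrnA; congr (_ *+ _); rewrite coefM.
(* If [I < i0] then [i1 = 0], and the claimed value is 0. *)
have [iI|Ii] := leqP i0 I; last first.
  have -> : i1 = 0%N by lia.
  rewrite mulr0n big1 // => i _; have iI := ltn_ord i.
  have [->|ai] := eqVneq (a`_j0`_i) 0; first by rewrite mul0r.
  rewrite coef_deriv.
  have [->|bi] := eqVneq (b`_j1`_(I - i).+1) 0; first by rewrite mul0rn mulr0.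
  by have [||_ ii _] := only _ _ _ _ 1%N ai bi isT; lia.
rewrite (bigD1 (Ordinal (iI : (i0 < I.+1)%N))) //= big1 ?addr0.
  have -> : i1 = (I - i0).+1 by lia.
  by rewrite coef_deriv mulrnAr.
move=> i; rewrite -val_eqE /= => ne; have iI' := ltn_ord i.
have [->|ai] := eqVneq (a`_j0`_i) 0; first by rewrite mul0r.
rewrite coef_deriv.
have [->|bi] := eqVneq (b`_j1`_(I - i).+1) 0; first by rewrite mul0rn mulr0.
by have [||_ ii _] := only _ _ _ _ 1%N ai bi isT; lia.
Qed.

Lemma vertices_parallel sg a b i0 j0 i1 j1 :
    1 < sg -> newton_vertex sg a i0 j0 -> newton_vertex sg b i1 j1 ->
    star a b - star b a = 1 ->
    (sg * j0%:R - i0%:R) + (sg * j1%:R - i1%:R) != sg - 1 ->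
  (j0 * i1 = j1 * i0)%N.
Proof.
move=> sg1 va vb; rewrite star_comm_restE => E ne.
have [i00|i0i1] := posnP (i0 + i1).
  have [-> ->] : i0 = 0%N /\ i1 = 0%N by lia.
  by rewrite !muln0.
have [j00|j0j1] := posnP (j0 + j1).
  have [-> ->] : j0 = 0%N /\ j1 = 0%N by lia.
  by rewrite !mul0n.
pose I := (i0 + i1).-1; pose J := (j0 + j1).-1.
have EI : (I.+1 = i0 + i1)%N by rewrite prednK.
have EJ : (J.+1 = j0 + j1)%N by rewrite prednK.
have EI' : (I.+1 = i1 + i0)%N by rewrite EI addnC.
have EJ' : (J.+1 = j1 + j0)%N by rewrite EJ addnC.
have := congr1 (fun c : S => c`_J`_I) E; rewrite /= !coefB.
rewrite (coef_star_rest_vertices sg1 va vb EI EJ).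
rewrite (coef_star_rest_vertices sg1 vb va EI' EJ').
(* At [I = J = 0] the total weight would be [sg - 1], the excluded value. *)
have -> : (1 : S)`_J`_I = 0.
  rewrite coef1; case: eqP => [J0|_]; last by rewrite coef0.
  rewrite coef1; case: eqP => [I0|//].
  have Ei : i0%:R + i1%:R = 1 :> rat by rewrite -natrD -EI I0.
  have Ej : j0%:R + j1%:R = 1 :> rat by rewrite -natrD -EJ J0.
  have Es : sg * (j0%:R + j1%:R) = sg by rewrite Ej mulr1.
  by case/negP: ne; apply/eqP; lra.
have := mulf_neq0 va.1 vb.1; rewrite (mulrC b`_j1`_i1).
move: (a`_j0`_i0 * b`_j1`_i1) => u u0 /subr0_eq H.
by apply: (pchar0_natr_inj charK0); apply: (mulfI u0); rewrite !mulr_natr.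
Qed.

(** Losing one power of [D] costs [sg], more than the gain of at most [i] from lowering the
    [x]-exponent. *)
Lemma top_vertex sg a i j : (size a <= j.+1)%N -> a`_j`_i != 0 ->
  (forall i', a`_j`_i' != 0 -> (i <= i')%N) -> i%:R < sg -> newton_vertex sg a i j.
Proof.
move=> sa aij imin isg; split=> // i' j' aij'.
have [jj'|j'j|jj'] := ltngtP j j'.
- by rewrite (nth_default _ (leq_trans sa jj')) coef0 eqxx in aij'.
- have : j'%:R + 1 <= j%:R :> rat by rewrite natr1 ler_nat.
  have : 0 <= i'%:R :> rat by [].
  have : 0 <= i%:R :> rat by [].
  move=> i0 i'0 j1; have : sg * (j'%:R + 1) <= sg * j%:R by rewrite ler_pM2l //; lra.
  by move=> ?; split; lra.
- subst j'; have := imin _ aij'; rewrite -(ler_nat rat) => ?.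
  by split=> //; lra.
Qed.

Lemma poly_low_order f : f != 0 ->
  exists2 i, f`_i != 0 & forall i', f`_i' != 0 -> (i <= i')%N.
Proof.
move=> f0; have ex : exists i, f`_i != 0.
  by exists (size f).-1; rewrite -/(lead_coef f) lead_coef_eq0.
by case: (ex_minnP ex) => i; exists i.
Qed.

Lemma poly2_support_bound a :
  exists N, forall i j, a`_j`_i != 0 -> (i < N)%N /\ (j < N)%N.
Proof.
exists (size a + \sum_(j < size a) size (a`_j)%R)%N => i j aij.
have ja : (j < size a)%N.
  by rewrite ltnNge; apply: contraNN aij => ja; rewrite (nth_default _ ja) coef0.
have ia : (i < size (a`_j)%R)%N.
  by rewrite ltnNge; apply: contraNN aij => ia; rewrite (nth_default _ ia).
rewrite (bigD1 (Ordinal ja)) //=; split; last exact: leq_trans (leq_addr _ _).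
by rewrite addnCA; apply: leq_trans (leq_addr _ _).
Qed.

(** The hypothesis makes the line of slope [sg] through the corner (d m, d) a supporting line; its
    lowest support point is the vertex. The minimality of [e] is kept so that [e = d] can be
    excluded when the line carries a lower point. *)
Lemma lower_vertex sg a d m : (size a <= d.+1)%N -> a`_d`_(d * m) != 0 ->
    (forall i j, a`_j`_i != 0 -> (d * m)%:R - i%:R <= sg * (d%:R - j%:R)) ->
  exists e i, [/\ (e <= d)%N, newton_vertex sg a i e,
    (d * m)%:R - i%:R = sg * (d%:R - e%:R) &
    forall i' j', a`_j'`_i' != 0 ->
      (d * m)%:R - i'%:R = sg * (d%:R - j'%:R) -> (e <= j')%N].
Proof.
move=> sa corner below.
pose on_line j := `[< exists2 i, a`_j`_i != 0 &
  (d * m)%:R - i%:R = sg * (d%:R - j%:R) >].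
have ex : exists j, on_line j.
  by exists d; apply/asboolP; exists (d * m)%N => //; rewrite !subrr mulr0.
case: (ex_minnP ex) => e /asboolP[i aie lie] emin.
have emin' i' j' : a`_j'`_i' != 0 ->
    (d * m)%:R - i'%:R = sg * (d%:R - j'%:R) -> (e <= j')%N.
  by move=> aij lij; apply: emin; apply/asboolP; exists i'.
exists e, i; split=> //.
- rewrite leqNgt; apply: contraNN aie => de.
  by rewrite (nth_default _ (leq_trans sa de)) coef0.
- split=> // i' j' aij; have := below _ _ aij => bij; split; first by lra.
  by move=> E; apply: (emin' i' j') => //; lra.
Qed.

(** * Divisibility of the [D]-degree of a dual *)

Lemma star_rest_coef00 a b : (forall j, (0 < j)%N -> a`_j`_0 = 0) ->
  (star_rest a b)`_0`_0 = 0.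
Proof.
(* The exceptional index is taken to be [j0 = 0], whose term has multiplicity 0. *)
move=> a0; have := @coef_star_rest1 K _ (coefp 0) a b 0 0 1 erefl _.
rewrite mulr0n /= /coefp; apply => j t j' /andP[t0 tj] _ _.
by rewrite coefM big_ord1 a0 ?mul0r // (leq_trans t0).
Qed.

(** A constant term of the commutator arises only when all the [D] of some monomial $D^j$ are spent
    on differentiation. This point on [x = 0] later forces a steep edge. *)
Lemma star_comm1_coef0 a b : star a b - star b a = 1 ->
  exists j, (0 < j)%N /\ (a`_j`_0 != 0 \/ b`_j`_0 != 0).
Proof.
rewrite star_comm_restE => E; apply: contrapT => no.
have z0 j : (0 < j)%N -> a`_j`_0 = 0 /\ b`_j`_0 = 0.
  move=> j0; split; apply/eqP/negPn/negP => z; apply: no; exists j; split=> //.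
    by left.
  by right.
have := congr1 (fun c : S => c`_0`_0) E; rewrite /= !coefB !star_rest_coef00.
- by rewrite subrr !coef1 /= => /esym/eqP; rewrite oner_eq0.
- by move=> j /z0[].
- by move=> j /z0[].
Qed.

Lemma top_corners_parallel a b n s i0 i1 : (1 < n)%N ->
    (size a <= n.+1)%N -> (size b <= s.+1)%N ->
    a`_n`_i0 != 0 -> (forall i, a`_n`_i != 0 -> (i0 <= i)%N) ->
    b`_s`_i1 != 0 -> (forall i, b`_s`_i != 0 -> (i1 <= i)%N) ->
  star a b - star b a = 1 -> (n * i1 = s * i0)%N.
Proof.
move=> n1 sa sb a0 mina b0 minb E.
(* Larger than [i0] and [i1], so both corners are vertices; as [1 < n], their total weight is at
   least [2 * sg - i0 - i1 = sg + 2], hence not [sg - 1]. *)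
pose sg : rat := (i0 + i1 + 2)%:R.
have sgE : sg = i0%:R + i1%:R + 2 by rewrite /sg !natrD.
have i00 : 0 <= i0%:R :> rat by [].
have i10 : 0 <= i1%:R :> rat by [].
apply: (vertices_parallel (sg := sg) _ _ _ E).
- lra.
- by apply: top_vertex => //; lra.
- by apply: top_vertex => //; lra.
- have : sg * 2 <= sg * n%:R by rewrite ler_pM2l ?ler_nat //; lra.
  have : 0 <= sg * s%:R by rewrite mulr_ge0 //; lra.
  by move=> ? ?; apply/eqP; lra.
Qed.

(** Over the finitely many support points below the corners, take the largest slope towards the
    corner of the same polynomial. One common slope serves both, since parallelism compares vertices
    in one direction. *)
Lemma exists_max_slope a b n s m :
    (size a <= n.+1)%N -> (size b <= s.+1)%N ->
    (forall i, a`_n`_i != 0 -> (n * m <= i)%N) ->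
    (forall i, b`_s`_i != 0 -> (s * m <= i)%N) ->
    (exists i j, a`_j`_i != 0 /\ (j < n)%N \/ b`_j`_i != 0 /\ (j < s)%N) ->
  exists sg : rat,
    [/\ forall i j, a`_j`_i != 0 -> (n * m)%:R - i%:R <= sg * (n%:R - j%:R),
        forall i j, b`_j`_i != 0 -> (s * m)%:R - i%:R <= sg * (s%:R - j%:R) &
        exists i j,
          [/\ a`_j`_i != 0, (j < n)%N & (n * m)%:R - i%:R = sg * (n%:R - j%:R)] \/
          [/\ b`_j`_i != 0, (j < s)%N & (s * m)%:R - i%:R = sg * (s%:R - j%:R)]].
Proof.
move=> sa sb mina minb ex.
pose c (x : bool) := if x then a else b; pose d (x : bool) := if x then n else s.
have [N HN] : exists N, forall x i j, (c x)`_j`_i != 0 -> (i < N)%N /\ (j < N)%N.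
  have [N1 H1] := poly2_support_bound a; have [N2 H2] := poly2_support_bound b.
  by exists (N1 + N2)%N => -[] i j /=; [case/H1|case/H2]; lia.
pose P (y : bool * 'I_N * 'I_N) :=
  ((c y.1.1)`_y.2`_y.1.2 != 0) && (y.2 < d y.1.1)%N.
pose F (y : bool * 'I_N * 'I_N) : rat :=
  ((d y.1.1 * m)%:R - (y.1.2 : nat)%:R) / ((d y.1.1)%:R - (y.2 : nat)%:R).
have [y0 Py0] : exists y, P y.
  have [x [i [j [cij jd]]]] : exists x i j, (c x)`_j`_i != 0 /\ (j < d x)%N.
    case: ex => i [j [] [cij jd]]; first by exists true, i, j.
    by exists false, i, j.
  have [iN jN] := HN _ _ _ cij.
  by exists (x, Ordinal iN, Ordinal jN); apply/andP.
case: (arg_maxP F Py0) => y /andP[cy yd] maxy.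
have pos x j : (j < d x)%N -> 0 < (d x)%:R - j%:R :> rat.
  by move=> jd; rewrite subr_gt0 ltr_nat.
have below x i j : (c x)`_j`_i != 0 -> (d x * m)%:R - i%:R <= F y * ((d x)%:R - j%:R).
  move=> cij; have [jd|dj|jd] := ltngtP j (d x).
  - have [iN jN] := HN _ _ _ cij.
    have := maxy (x, Ordinal iN, Ordinal jN); rewrite /P /= cij jd => /(_ isT).
    by rewrite /F /= ler_pdivrMr ?pos.
  - have cj : (size (c x) <= j)%N.
      by case: (x) dj => /= dj; [apply: leq_trans sa _|apply: leq_trans sb _].
    by rewrite (nth_default _ cj) coef0 eqxx in cij.
  - rewrite jd subrr mulr0 subr_le0 ler_nat; subst j.
    by case: (x) cij => /=; [apply: mina|apply: minb].
exists (F y); split; [exact: (below true)|exact: (below false)|].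
have yE : (d y.1.1 * m)%:R - (y.1.2 : nat)%:R =
    F y * ((d y.1.1)%:R - (y.2 : nat)%:R) by rewrite /F divfK ?gt_eqF ?pos.
exists y.1.2, y.2; move: cy yd yE; case: (y) => -[[] i] j /= ? ? ?; [left|right]; by [].
Qed.

Lemma star_comm1_dvd a b n s : prime n ->
    (size a <= n.+1)%N -> (size b <= s.+1)%N -> a`_n != 0 -> b`_s != 0 ->
    a`_n`_0 = 0 -> star a b - star b a = 1 -> (n %| s)%N.
Proof.
move=> n_pr sa sb an0 bs0 root0 E; apply/negPn/negP => nds.
have n1 := prime_gt1 n_pr.
have s0 : (0 < s)%N by rewrite lt0n; apply: contraNN nds => /eqP ->; rewrite dvdn0.
have cop : coprime n s by rewrite prime_coprime.
have [i0 ai0 mina] := poly_low_order an0.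
have [i1 bi1 minb] := poly_low_order bs0.
have par := top_corners_parallel n1 sa sb ai0 mina bi1 minb E.
have [m i0E] : exists m, i0 = (n * m)%N.
  have : (n %| i0)%N by rewrite -(Gauss_dvdr _ cop) -par dvdn_mulr.
  by move/dvdnP => [m ->]; exists m; rewrite mulnC.
have i1E : i1 = (s * m)%N.
  by apply/eqP; rewrite -(eqn_pmul2l (ltnW n1)) par i0E mulnCA.
(* With [m = 0] the leading coefficient of [a] would not vanish at 0. *)
have m0 : (0 < m)%N.
  by rewrite lt0n; apply: contraNneq ai0 => m0; rewrite i0E m0 muln0 root0.
subst i0 i1.
have atop : forall j, a`_j`_0 != 0 -> (j < n)%N.
  move=> j aj; rewrite ltn_neqAle; apply/andP; split.
    by apply: contraNneq aj => ->; rewrite root0.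
  by rewrite -ltnS; apply: leq_trans sa; rewrite ltnNge; apply: contraNN aj => jj;
    rewrite (nth_default _ jj) coef0.
have btop : forall j, b`_j`_0 != 0 -> (j < s)%N.
  move=> j bj; rewrite ltn_neqAle; apply/andP; split.
    by apply/eqP => js; move: bj; rewrite js => /minb; lia.
  by rewrite -ltnS; apply: leq_trans sb; rewrite ltnNge; apply: contraNN bj => jj;
    rewrite (nth_default _ jj) coef0.
have [j [j0 aj]] := star_comm1_coef0 E.
have [|sg [belowa belowb [i' [j' steep]]]] := exists_max_slope sa sb mina minb.
  by case: aj => aj; exists 0%N, j; [left|right]; split=> //; [apply: atop|apply: btop].
have n1' : 2 <= n%:R :> rat by rewrite ler_nat.
have s1' : 1 <= s%:R :> rat by rewrite ler1n.
have m1' : 1 <= m%:R :> rat by rewrite ler1n.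
(* The supporting line bounds the point (0, j): d m <= sg (d - j), that is sg j <= d (sg - m), and
   [j >= 1]. *)
have steep0 d (dj : (j < d)%N) : (d * m)%:R - 0%:R <= sg * (d%:R - j%:R) ->
    sg > 0 /\ sg <= d%:R * (sg - m%:R).
  have d1 : 1 <= d%:R :> rat by rewrite ler1n (leq_ltn_trans _ dj).
  have dj' : 1 <= d%:R - j%:R :> rat by rewrite lerBrDr addrC natr1 ler_nat.
  have j1 : 1 <= j%:R :> rat by rewrite ler1n.
  rewrite natrM subr0 => H.
  have dm0 : 0 < d%:R * m%:R :> rat by rewrite mulr_gt0 //; lra.
  have sg0 : 0 < sg by rewrite -(@pmulr_lgt0 _ (d%:R - j%:R)); lra.
  split=> //; have : sg * 1 <= sg * j%:R by rewrite ler_pM2l.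
  lra.
(* The product (n + s)(sg - m) is the total weight of the two lower vertices; being at least [sg],
   it is not [sg - 1]. *)
have [sgm sgdeg] : m%:R < sg /\ sg <= (n%:R + s%:R) * (sg - m%:R).
  have aux d : 1 <= d%:R :> rat -> sg > 0 /\ sg <= d%:R * (sg - m%:R) -> m%:R < sg.
    move=> d1 [sg0 H]; rewrite -subr_gt0 -(@pmulr_rgt0 _ d%:R); lra.
  case: aj => aj.
  - have H := steep0 _ (atop _ aj) (belowa _ _ aj).
    have sgm : m%:R < sg by apply: (aux n) => //; lra.
    split=> //; have : 0 <= s%:R * (sg - m%:R) by rewrite mulr_ge0 //; lra.
    by case: H => *; lra.
  - have H := steep0 _ (btop _ aj) (belowb _ _ aj).
    have sgm : m%:R < sg by apply: (aux s) => //; lra.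
    split=> //; have : 0 <= n%:R * (sg - m%:R) by rewrite mulr_ge0 //; lra.
    by case: H => *; lra.
have [e [u [en va lu mine]]] := lower_vertex sa ai0 belowa.
have [e' [u' [es vb lu' mine']]] := lower_vertex sb bi1 belowb.
rewrite natrM in lu; rewrite natrM in lu'.
have par' := vertices_parallel (_ : 1 < sg) va vb E.
have {par'} par' : (e * u' = e' * u)%N.
  by apply: par'; [lra|apply/eqP; lra].
(* Inserting the equations of the two lines into [e * u' = e' * u] leaves (m - sg)(n e' - s e) =
   0. *)
have ratio : (n * e' = s * e)%N.
  apply/eqP; rewrite -(eqr_nat rat) !natrM -subr_eq0.
  have : (m%:R - sg) * (n%:R * e'%:R - s%:R * e%:R) == 0.
    have := congr1 (fun x => x%:R : rat) par'; rewrite /= !natrM.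
    have -> : u%:R = n%:R * m%:R - sg * (n%:R - e%:R) by lra.
    have -> : u'%:R = s%:R * m%:R - sg * (s%:R - e'%:R) by lra.
    by move=> H; apply/eqP; lra.
  by rewrite mulf_eq0 => /orP[/eqP/subr0_eq msg|//]; rewrite -msg ltxx in sgm.
have ne : (n %| e)%N by rewrite -(Gauss_dvdr _ cop) -ratio dvdn_mulr.
(* If [e = 0], the line gives [u = n (m - sg) < 0]. *)
have [e0|e0] := posnP e.
  have : 0 <= u%:R :> rat by [].
  have : 0 < n%:R * (sg - m%:R) by rewrite mulr_gt0 ?subr_gt0 //; lra.
  by rewrite e0 in lu; lra.
have eE : e = n by apply/eqP; rewrite eqn_leq en dvdn_leq.
have e'E : e' = s.
  by apply/eqP; rewrite -(eqn_pmul2l (ltnW n1)) ratio eE mulnC.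
(* Now both lower vertices are the corners, although the slope is attained strictly below one of
   them. *)
case: steep => -[st jd].
  by move/(mine _ _ st); rewrite eE leqNgt jd.
by move/(mine' _ _ st); rewrite e'E leqNgt jd.
Qed.

End Newton.

(** * Symbols of Weyl algebra elements *)

Section Symbol.
Variable K : fieldType.
Local Notation S := {poly {poly K}}.
Implicit Types (a b c : S) (f g : {poly K}).

(** Since [f] may be 0, this is a degree bound with a recorded coefficient, stable under sums
    whatever cancels. *)
Definition has_top d f a := (size a <= d.+1)%N /\ a`_d = f.

Lemma has_topD d f g a b :
  has_top d f a -> has_top d g b -> has_top d (f + g) (a + b).
Proof.
move=> [sa af] [sb bg]; split; last by rewrite coefD af bg.
by rewrite (leq_trans (size_polyD _ _)) // geq_max sa sb.
Qed.

Lemma has_topZ d f g a : has_top d f a -> has_top d (g * f) (g *: a).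
Proof.
by move=> [sa af]; split; rewrite ?coefZ ?af // (leq_trans (size_scale_leq _ _)).
Qed.

Lemma has_topZ0 d g a : has_top d 0 a -> has_top d 0 (g *: a).
Proof. by move/(has_topZ g); rewrite mulr0. Qed.

Lemma has_top0 d : has_top d 0 (0 : S).
Proof. by split; rewrite ?size_poly0 ?coef0. Qed.

Lemma has_top_lt d e f a : (d < e)%N -> has_top d f a -> has_top e 0 a.
Proof.
move=> de [sa _]; split; first by rewrite (leq_trans sa) // ltnW.
by rewrite nth_default // (leq_trans sa).
Qed.

Lemma has_top_sum d (I : Type) (r : seq I) (F : I -> {poly K}) (A : I -> S) :
  (forall i, has_top d (F i) (A i)) ->
  has_top d (\sum_(i <- r) F i) (\sum_(i <- r) A i).
Proof.
move=> FA; elim: r => [|i r IH]; first by rewrite !big_nil; apply: has_top0.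
by rewrite !big_cons; apply: has_topD.
Qed.

Lemma has_top_sum0 d (I : Type) (r : seq I) (A : I -> S) :
  (forall i, has_top d 0 (A i)) -> has_top d 0 (\sum_(i <- r) A i).
Proof. by move=> /(@has_top_sum d I r (fun=> 0)); rewrite big1_eq. Qed.

Lemma has_top_lmulD d f b : has_top d f b -> has_top d.+1 f (lmulD b).
Proof.
move=> [sb bf]; rewrite -[f]addr0; apply: has_topD; last first.
  by apply: (@has_top_lt d _ (f^`())) => //; split; rewrite ?coef_derx ?bf //;
    rewrite (leq_trans (size_poly _ _)).
split; last by rewrite coefXM.
by have [->|b0] := eqVneq b 0; rewrite ?mulr0 ?size_poly0 // mulrC size_mulX.
Qed.

Lemma has_top_star d e f g a b :
  has_top d f a -> has_top e g b -> has_top (d + e) (f * g) (star a b).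
Proof.
move=> [sa af] tb.
have iter_top j : has_top (j + e) g (iter j (@lmulD K) b).
  by elim: j => //= j IH; apply: has_top_lmulD.
rewrite (starE b sa) big_ord_recr /= -[f * g]add0r; apply: has_topD; last first.
  by rewrite af; apply: has_topZ.
apply: has_top_sum0 => j; apply: has_topZ0.
by apply: has_top_lt (iter_top j); rewrite ltn_add2r.
Qed.

Variables P Q : S.

(** The images [P] and [Q] of the generators stay free, so that either generator can be sent to [D]
    up to sign. *)
Fixpoint wterm_symbol (x : wterm K) : S :=
  match x with
  | WConst u => u%:P%:P
  | WP => P
  | WQ => Q
  | WAdd y z => wterm_symbol y + wterm_symbol z
  | WOpp y => - wterm_symbol y
  | WMul y z => star (wterm_symbol y) (wterm_symbol z)
  end.

Definition weyl_symbol (u : weyl K) := wterm_symbol (repr u).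

Hypothesis PQ : star Q P - star P Q = 1.

Lemma wterm_symbol_cong x y : wcong x y -> wterm_symbol x = wterm_symbol y.
Proof.
elim=> {x y} //=.
- by move=> y x z _ -> _ ->.
- by move=> x x' y y' _ -> _ ->.
- by move=> x x' _ ->.
- by move=> x x' y y' _ -> _ ->.
- by move=> x y z; rewrite addrA.
- by move=> x y; rewrite addrC.
- by move=> x; rewrite polyC0 add0r.
- by move=> x; rewrite polyC0 addNr.
- by move=> x y z; rewrite star_assoc.
- by move=> x; rewrite star_polyC polyC1 scale1r.
- by move=> x y z; rewrite starDl.
- by move=> x y z; rewrite starDr.
- by move=> u v; rewrite !polyCD.
- by move=> u v; rewrite star_polyC !polyCM mul_polyC.
- move=> u x; rewrite star_polyC -[u%:P%:P]mulr1 mul_polyC.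
  by rewrite starZr star1r.
Qed.

Lemma weyl_symbol_class x : weyl_symbol (weyl_class x) = wterm_symbol x.
Proof. exact/wterm_symbol_cong/wcong_repr. Qed.

Lemma weyl_symbolD u v : weyl_symbol (u + v) = weyl_symbol u + weyl_symbol v.
Proof. by rewrite /GRing.add /= weyl_symbol_class. Qed.

Lemma weyl_symbolN u : weyl_symbol (- u) = - weyl_symbol u.
Proof. by rewrite /GRing.opp /= weyl_symbol_class. Qed.

Lemma weyl_symbolM u v : weyl_symbol (u * v) = star (weyl_symbol u) (weyl_symbol v).
Proof. by rewrite /GRing.mul /= weyl_symbol_class. Qed.

Lemma weyl_symbolZ t u : weyl_symbol (t *: u) = t%:P *: weyl_symbol u.
Proof. by rewrite /GRing.scale /= weyl_symbol_class /= star_polyC. Qed.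

Lemma weyl_symbol1 : weyl_symbol 1 = 1.
Proof. by rewrite /GRing.one /= weyl_symbol_class /= !polyC1. Qed.

Lemma weyl_symbol0 : weyl_symbol 0 = 0.
Proof. by rewrite -[0](subrr 1) weyl_symbolD weyl_symbolN subrr. Qed.

Lemma weyl_symbol_sum I (r : seq I) (F : I -> weyl K) :
  weyl_symbol (\sum_(i <- r) F i) = \sum_(i <- r) weyl_symbol (F i).
Proof. exact: (big_morph weyl_symbol weyl_symbolD weyl_symbol0). Qed.

Lemma has_top_weylX d f u t : has_top d f (weyl_symbol u) ->
  has_top (d * t) (f ^+ t) (weyl_symbol (u ^+ t)).
Proof.
move=> tu; elim: t => [|t IH].
  by rewrite muln0 !expr0 weyl_symbol1; split; rewrite ?size_poly1 ?coef1.
by rewrite mulnS !exprS weyl_symbolM; apply: has_top_star.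
Qed.

Lemma has_top_monomial dp dq f g i j : has_top dp f P -> has_top dq g Q ->
  has_top (dp * i + dq * j) (f ^+ i * g ^+ j)
    (weyl_symbol (weyl_p ^+ i * weyl_q ^+ j)).
Proof.
move=> tP tQ; rewrite weyl_symbolM; apply: has_top_star; apply: has_top_weylX.
  by rewrite /weyl_p weyl_symbol_class.
by rewrite /weyl_q weyl_symbol_class.
Qed.

Hypothesis charK0 : [pchar K] =i pred0.

(** Descent on the [D]-degree of [w]: any dual can be replaced by one of smaller degree. *)
Lemma no_dual_of_prime_degree n f (z w : weyl K) : prime n ->
  has_top n f (weyl_symbol z) -> f != 0 -> f`_0 = 0 -> comm_bracket z w <> 1.
Proof.
move=> n_pr [sz topz] f0 f00.
have [d] := ubnP (size (weyl_symbol w)); elim: d w => // d IH w wd E.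
set a := weyl_symbol z in sz topz; pose b := weyl_symbol w.
have Eab : star a b - star b a = 1.
  by rewrite -!weyl_symbolM -weyl_symbolN -weyl_symbolD -/(comm_bracket _ _) E
    weyl_symbol1.
have b0 : b != 0.
  apply/eqP=> b0; move/eqP: Eab.
  by rewrite b0 star0l star0r subr0 eq_sym oner_eq0.
pose s := (size b).-1.
have sb : size b = s.+1 by rewrite /s prednK // lt0n size_poly_eq0.
have sb' : (size b <= s.+1)%N by rewrite sb.
have bs0 : b`_s != 0 by rewrite -/(lead_coef b) lead_coef_eq0.
have an0 : a`_n != 0 by rewrite topz.
have an00 : a`_n`_0 = 0 by rewrite topz.
have /dvdnP[t st] := star_comm1_dvd charK0 n_pr sz sb' an0 bs0 an00 Eab.
rewrite mulnC in st.
have sb'' : (size b <= (n * t).+1)%N by rewrite -st.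
have [u bu] := star_comm1_top_power charK0 (prime_gt1 n_pr) sz sb'' an0 Eab.
(* Powers of [z] commute with [z], so the bracket is unchanged, while the top coefficient of [w]
   cancels. *)
apply: (IH (w - u *: z ^+ t)).
  have [szt topzt] := @has_top_weylX n f z t (conj sz topz).
  have top0 : (weyl_symbol (w - u *: z ^+ t))`_s = 0.
    rewrite weyl_symbolD weyl_symbolN weyl_symbolZ coefB coefZ -/b {2}st topzt.
    by rewrite st bu topz mul_polyC subrr.
  have small : (size (weyl_symbol (w - u *: z ^+ t)%R) <= s.+1)%N.
    rewrite weyl_symbolD weyl_symbolN weyl_symbolZ.
    rewrite (leq_trans (size_polyD _ _)) // size_polyN geq_max sb' /=.
    by rewrite (leq_trans (size_scale_leq _ _)) // st.
  have : (s < d)%N by rewrite -ltnS -sb.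
  apply: leq_trans; rewrite ltnS; apply/leq_sizeP => i; rewrite leq_eqVlt.
  case/predU1P => [<- //|si]; by rewrite nth_default // (leq_trans small).
rewrite /comm_bracket -E /comm_bracket mulrBr mulrBl -scalerAr -scalerAl.
by rewrite -exprS -exprSr opprB addrA subrK.
Qed.

End Symbol.

(** * Choice of coordinates and conclusion *)

Lemma star_weyl_relation (K : fieldType) (f : {poly K}) : f^`() = 1 ->
  star 'X f%:P - star f%:P 'X = 1.
Proof.
move=> df; rewrite starX star_polyC /lmulD.
have -> : derx f%:P = 1.
  apply/polyP=> i; rewrite coef_derx coef1 coefC.
  by case: (i == 0)%N; rewrite ?df ?deriv0.
by rewrite mulrC mul_polyC addrAC subrr add0r.
Qed.

(** Algebraic closedness supplies a root [u] of [h], which the translation moves to 0. *)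
Lemma closed_shift_root (K : closedFieldType) (h : {poly K}) : (1 < size h)%N ->
  exists u, h \Po ('X + u%:P) != 0 /\ (h \Po ('X + u%:P))`_0 = 0.
Proof.
move=> h1; have /closed_rootP[u /rootP hu] : size h != 1%N by rewrite gtn_eqF.
exists u; rewrite comp_poly_eq0 ?size_XaddC // -horner_coef0 horner_comp.
by rewrite !hornerE hu -size_poly_gt0 ltnW.
Qed.

Local Open Scope classical_set_scope.

Theorem theorem1p2 (K : closedFieldType) (charK0 : [pchar K] =i pred0)
    (k n : nat) (n_ge1 : (1 <= n)%N) (n_lt_k : (n < k)%N)
    (prime_kn : prime k || prime n) :
  weyl_Gamma K `&` weyl_box K k n = set0.
Proof.
rewrite -subset0 => z [[w zw] [a [akn _ zE]]].
pose F u : {poly K} := 'X + u%:P.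
have dF u : (F u)^`() = 1 by rewrite derivD derivX derivC addr0.
have topF u : has_top 0 (F u) (F u)%:P by split; rewrite ?size_polyC_leq1 ?coefC.
have top_sum d I (r : seq I) := @has_top_sum K d I r.
case/orP: prime_kn => [k_pr|n_pr].
(* Here [p] goes to [-D] and [q] to [x + u], so the [D]-degree is [k]; [h] is nonconstant because
   [n >= 1]. *)
- pose h := \poly_(j < n.+1) a k j.
  have sh : size h = n.+1 by rewrite size_poly_eq.
  have [|u [hu0 hu00]] := @closed_shift_root K h; first by rewrite sh.
  have topP : has_top 1 (-1) (- 'X : {poly {poly K}}).
    by split; rewrite ?size_polyN ?size_polyX // coefN coefX.
  have rel : star (F u)%:P (- 'X) - star (- 'X) (F u)%:P = 1.
    rewrite -scaleN1r starZl -[-1]polyCN -polyC1 starZr polyCN polyC1 !scaleN1r.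
    by rewrite opprK addrC star_weyl_relation.
  apply: (no_dual_of_prime_degree (f := (-1) ^+ k * (h \Po F u)) rel charK0 k_pr
    _ _ _ zw); last 2 first.
  + by rewrite mulf_neq0 ?expf_neq0 ?oppr_eq0 ?oner_eq0.
  + by rewrite -!horner_coef0 in hu00 *; rewrite hornerM hu00 mulr0.
  rewrite zE weyl_symbol_sum //.
  (* Only the row [i = k] reaches degree [k]; the top is written as a sum with one nonzero term to
     match [has_top_sum]. *)
  have -> : (-1) ^+ k * (h \Po F u) = \sum_(i < k.+1)
      (if i == k :> nat then (-1) ^+ k * (h \Po F u) else 0).
    by rewrite -big_mkcond (big_pred1 ord_max).
  apply: has_top_sum => i; rewrite weyl_symbol_sum //.
  have [ik|ik] := eqVneq (i : nat) k.
    rewrite comp_polyE sh mulr_sumr ik; apply: has_top_sum => j.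
    rewrite coef_poly ltn_ord -scalerAr -mul_polyC weyl_symbolZ //.
    apply: has_topZ.
    by have := has_top_monomial rel k j topP (topF u); rewrite mul1n mul0n addn0.
  apply: has_top_sum0 => j; rewrite weyl_symbolZ //.
  apply: has_topZ0; have := has_top_monomial rel i j topP (topF u).
  rewrite mul1n mul0n addn0; apply: has_top_lt.
  by rewrite ltn_neqAle ik -ltnS ltn_ord.
(* Here [p] goes to [x + u] and [q] to [D], so the [D]-degree is [n]. *)
- pose h := \poly_(i < k.+1) a i n.
  have sh : size h = k.+1 by rewrite size_poly_eq.
  have [|u [hu0 hu00]] := @closed_shift_root K h.
    by rewrite sh ltnS (leq_trans n_ge1) // ltnW.
  have topQ : has_top 1 1 ('X : {poly {poly K}}).
    by split; rewrite ?size_polyX ?coefX.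
  have rel : star 'X (F u)%:P - star (F u)%:P 'X = 1 by rewrite star_weyl_relation.
  apply: (no_dual_of_prime_degree (f := h \Po F u) rel charK0 n_pr _ hu0 hu00 zw).
  rewrite zE weyl_symbol_sum // comp_polyE sh; apply: has_top_sum => i.
  have top i' j := has_top_monomial rel i' j (topF u) topQ.
  rewrite weyl_symbol_sum // big_ord_recr /= -[X in has_top _ X]add0r.
  apply: has_topD.
    apply: has_top_sum0 => j; rewrite weyl_symbolZ //; apply: has_topZ0.
    have := top i j; rewrite mul0n mul1n; apply: has_top_lt.
    exact: ltn_ord.
  rewrite coef_poly ltn_ord -mul_polyC weyl_symbolZ //; apply: has_topZ.
  by have := top i n; rewrite mul0n mul1n expr1n mulr1.
Qed.
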